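(* Let $V$ be a vertex algebra over $\mathbb{C}$. Let $U$ be a subspace of $V$ equipped with a vector space decomposition $U=\coprod_{n\ge1}U_n$. For $n\ge0$ let $E_n^U$ be the subspace of $V$ linearly spanned by the vectors $$u^{(1)}_{-n_1}\cdots u^{(r)}_{-n_r}\mathbf{1}$$ with $r\ge0$, $u^{(i)}\in U_{m_i}$, $m_i\ge1$, $n_i\ge1$ and $m_1+\cdots+m_r\le n$; set $E_n^U=0$ for $n<0$. Suppose that $U$ generates $V$ as a vertex algebra, i.e. $V=\mathrm{span}\{u^{(1)}_{n_1}\cdots u^{(r)}_{n_r}\mathbf{1}\mid r\ge0,\ u^{(i)}\in U,\ n_i\in\mathbb{Z}\}$, and suppose that $$u_iv\in E^U_{m+n-1}\quad\text{for all }u\in U_m,\ v\in U_n,\ i\ge0,\ m,n\ge1.$$ Then $E_U=\{E_n^U\}$ is a good filtration of $V$. In particular, $$V=\bigcup_{n\ge0}E_n^U=\mathrm{span}\{u^{(1)}_{-n_1}\cdots u^{(r)}_{-n_r}\mathbf{1}\mid r\ge0,\ u^{(i)}\in U,\ n_i\ge1\}.$$ Furthermore, every good filtration $E=\{E_n\}$ of $V$ with $E_n=0$ for $n<0$ and $E_0=\mathbb{C}\mathbf{1}$ arises in this way, i.e. there is a subspace $U=\coprod_{n\ge1}U_n$ of $V$ such that $U$ generates $V$ as a vertex algebra, such that $u_iv\in E^U_{m+n-1}$ for all $u\in U_m$, $v\in U_n$, $i\ge0$, $m,n\ge1$, and such that $E_n=E_n^U$ for all $n$.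
   Context: Vertex algebra: a vector space $V$ over $\mathbb{C}$ with a linear map $Y:V\to\mathrm{Hom}(V,V((x)))$, $v\mapsto Y(v,x)=\sum_{n\in\mathbb{Z}}v_nx^{-n-1}$ ($v_n\in\mathrm{End}\,V$), and a vector $\mathbf{1}\in V$ such that $Y(\mathbf{1},x)=\mathrm{id}$; $Y(v,x)\mathbf{1}\in V[[x]]$ with $v_{-1}\mathbf{1}=v$ for $v\in V$; and for $u,v\in V$ the Jacobi identity holds: $$x_0^{-1}\delta\left(\tfrac{x_1-x_2}{x_0}\right)Y(u,x_1)Y(v,x_2)-x_0^{-1}\delta\left(\tfrac{x_2-x_1}{-x_0}\right)Y(v,x_2)Y(u,x_1)=x_2^{-1}\delta\left(\tfrac{x_1-x_0}{x_2}\right)Y(Y(u,x_0)v,x_2),$$ where $\delta(x)=\sum_{n\in\mathbb{Z}}x^n$ and powers of binomials are expanded in nonnegative powers of the second variable. Good filtration of $V$: an increasing family of subspaces $\cdots\subset E_{-1}\subset E_0\subset E_1\subset\cdots$ ($n\in\mathbb{Z}$) with $\bigcup_{n\in\mathbb{Z}}E_n=V$, $\mathbf{1}\in E_0$, and for $u\in E_m$, $v\in E_n$: $u_jv\in E_{m+n}$ for $j<0$ and $u_jv\in E_{m+n-1}$ for $j\ge0$. *)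

(* Defs.v *)
From HB Require Import structures.
From mathcomp Require Import all_boot all_order all_algebra.
From mathcomp Require Import complex.
From mathcomp Require Import boolp classical_sets functions cardinality fsbigop.
From mathcomp Require Import reals.

Set Implicit Arguments.
Unset Strict Implicit.
Unset Printing Implicit Defensive.

Import Order.TTheory GRing.Theory Num.Theory.

Local Open Scope classical_set_scope.
Local Open Scope ring_scope.

(* Formal series in x0, x1, x2, infinite in both directions: f a b c is the
   coefficient of x0^a x1^b x2^c. *)
Definition series3 (T : Type) := int -> int -> int -> T.

Definition binz (K : numFieldType) (n : int) (k : nat) : K :=
  (\prod_(i < k) (n - i%:Z)%:~R) / (k`!)%:R.

(* Coefficient of x^a y^b in (x - y)^n, expanded in nonnegative powers of y. *)
Definition subX_coef (K : numFieldType) (n a b : int) : K :=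
  if (0 <= b) && (a + b == n) then (-1) ^ b * binz K n `|b|%N else 0.

(* x0^-1 delta((x1 - x2) / x0) = sum_n x0^(-n-1) (x1 - x2)^n *)
Definition delta12 (K : numFieldType) : series3 K :=
  fun a b c => subX_coef K (- a - 1) b c.

(* x0^-1 delta((x2 - x1) / (- x0)) = sum_n (-1)^n x0^(-n-1) (x2 - x1)^n *)
Definition delta21 (K : numFieldType) : series3 K :=
  fun a b c => (-1) ^ (- a - 1) * subX_coef K (- a - 1) c b.

(* x2^-1 delta((x1 - x0) / x2) = sum_n x2^(-n-1) (x1 - x0)^n *)
Definition delta10 (K : numFieldType) : series3 K :=
  fun a b c => subX_coef K (- c - 1) b a.

(* A sum \sum_(i \in A) without finite support is 0 by convention; in the
   Jacobi identity below, truncation makes every support finite. *)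
Definition mul3 (K : numFieldType) (V : lmodType K)
    (f : series3 K) (g : series3 V) : series3 V :=
  fun a b c => \sum_(i \in [set: int * int * int])
    f i.1.1 i.1.2 i.2 *: g (a - i.1.1) (b - i.1.2) (c - i.2).

Section Modes.
Variables (K : numFieldType) (V : lmodType K).
(* Y u n v stands for u_n v, so that Y(u, x) v = sum_n (Y u n v) x^(-n-1). *)
Variable Y : V -> int -> V -> V.

(* Y(u, x1) Y(v, x2) w *)
Definition prodY12 (u v w : V) : series3 V :=
  fun a b c => if a == 0 then Y u (- b - 1) (Y v (- c - 1) w) else 0.

(* Y(v, x2) Y(u, x1) w *)
Definition prodY21 (u v w : V) : series3 V :=
  fun a b c => if a == 0 then Y v (- c - 1) (Y u (- b - 1) w) else 0.

(* Y(Y(u, x0) v, x2) w *)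
Definition iterY (u v w : V) : series3 V :=
  fun a b c => if b == 0 then Y (Y u (- a - 1) v) (- c - 1) w else 0.

Definition jacobi_identity (u v w : V) : Prop :=
  forall a b c : int,
    mul3 (delta12 K) (prodY12 u v w) a b c
      - mul3 (delta21 K) (prodY21 u v w) a b c
    = mul3 (delta10 K) (iterY u v w) a b c.

End Modes.

Record vertexAlgebra (K : numFieldType) := VertexAlgebra {
  va_sort :> lmodType K;
  va_mode : va_sort -> int -> va_sort -> va_sort;
  va_vac : va_sort;
  va_linearl : forall (n : int) (w : va_sort),
    linear (fun v : va_sort => va_mode v n w);
  va_linearr : forall (v : va_sort) (n : int), linear (va_mode v n);
  va_trunc : forall v w : va_sort,
    exists N : int, forall n : int, N <= n -> va_mode v n w = 0;
  va_vacl : forall (n : int) (w : va_sort),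
    va_mode va_vac n w = if n == -1 then w else 0;
  va_creation0 : forall (v : va_sort) (n : int),
    0 <= n -> va_mode v n va_vac = 0;
  va_creation : forall v : va_sort, va_mode v (-1) va_vac = v;
  va_jacobi : forall u v w : va_sort, jacobi_identity va_mode u v w
}.

Section Subspaces.
Variables (K : numFieldType) (V : lmodType K).

Definition subspace (A : set V) : Prop := submod_closed [in A].

Definition lspan (A : set V) : set V :=
  [set v | exists (r : nat) (a : 'I_r -> K) (x : 'I_r -> V),
     (forall i, A (x i)) /\ v = \sum_(i < r) a i *: x i].

(* U is the internal direct sum of the D n for n >= 1; D 0 plays no role. *)
Definition graded_decomposition (U : set V) (D : nat -> set V) : Prop :=
  [/\ subspace U,
      forall n, (0 < n)%N -> subspace (D n),
      U = lspan (\bigcup_(n in [set n | (0 < n)%N]) D n) &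
      forall (N : nat) (x : nat -> V),
        (forall n, (0 < n)%N -> D n (x n)) ->
        \sum_(1 <= n < N.+1) x n = 0 ->
        forall n, (0 < n <= N)%N -> x n = 0].

End Subspaces.

Section Filtrations.
Variables (K : numFieldType) (V : vertexAlgebra K).

(* word [:: (u1, n1); ...; (ur, nr)] is (u1)_n1 ... (ur)_nr 1. *)
Definition word (s : seq (V * int)) : V :=
  foldr (fun t w => va_mode t.1 t.2 w) (va_vac V) s.

Definition generates (U : set V) : Prop :=
  lspan [set word s | s in
    [set s : seq (V * int) | forall t, t \in s -> U t.1]] = [set: V].

(* A triple (u, m, n) in s stands for the operator u_(-n) with u in D m. *)
Definition EU (D : nat -> set V) (n : int) : set V :=
  match n with
  | Posz k =>
      lspan [set word [seq (t.1.1, - t.2%:Z) | t <- s] | s in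
        [set s : seq (V * nat * nat) |
           (forall t, t \in s ->
              [/\ (0 < t.1.2)%N, (0 < t.2)%N & D t.1.2 t.1.1])
           /\ (\sum_(t <- s) t.1.2 <= k)%N]]
  | Negz _ => [set 0]
  end.

Record good_filtration (E : int -> set V) : Prop := GoodFiltration {
  gf_subspace : forall n, subspace (E n);
  gf_incr : forall n, E n `<=` E (n + 1);
  gf_exhaustive : \bigcup_(n in [set: int]) E n = [set: V];
  gf_vac : E 0 (va_vac V);
  gf_neg : forall (m n : int) (u v : V) (j : int),
    E m u -> E n v -> j < 0 -> E (m + n) (va_mode u j v);
  gf_nneg : forall (m n : int) (u v : V) (j : int),
    E m u -> E n v -> 0 <= j -> E (m + n - 1) (va_mode u j v)
}.

Definition nneg_products_lower (D : nat -> set V) : Prop :=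
  forall (m n : nat) (u v : V) (i : int),
    (0 < m)%N -> (0 < n)%N -> D m u -> D n v -> 0 <= i ->
    EU D (m%:Z + n%:Z - 1) (va_mode u i v).

End Filtrations.

(* Main.v *)
Require Import Defs.
From HB Require Import structures.
From mathcomp Require Import all_boot all_order all_algebra.
From mathcomp Require Import complex.
From mathcomp Require Import boolp classical_sets functions cardinality fsbigop.
From mathcomp Require Import reals.
From mathcomp Require Import zify.

Import Order.TTheory GRing.Theory Num.Theory.

Local Open Scope classical_set_scope.
Local Open Scope ring_scope.

(* Writing [E_n] for [E_n^U], one shows [a_j v \in E_(m+n)], and even
   [a_j v \in E_(m+n-1)] when [j >= 0], for [a \in E_m] and [v \in E_n], by
   induction on [m + n]. If [a = u \in U_m] and [v = u'_(-k) v'] with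
   [u' \in U_q], the commutator formula reduces [u_i v] for [i >= 0] to
   [u'_(-k) u_i v'], covered by induction on the word [v], and to
   [(u_j u')_(i-k-j) v'] with [u_j u' \in E_(m+q-1)], of smaller total degree.
   For a general word [a = u_(-k) a'], the iterate formula expresses [a_j v]
   through [u_(-k-i) a'_(j+i) v] and [a'_(j-k-i) u_i v] with [i >= 0], and both
   are covered by the previous step and the induction hypothesis. Since only
   membership in a subspace matters, no coefficient of these formulas other
   than the leading one is needed.

   Conversely, for a good filtration [E], let [U_n] be a vector space complement
   of [E_(n-1)] in [E_n]. *)

(** * Subspaces, spans and complements *)

Section LinearAlgebra.
Set Implicit Arguments.
Unset Strict Implicit.
Context {K : numFieldType} {V : lmodType K}.
Implicit Types (A B C P : set V).

Lemma subspaceP A :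
  subspace A <-> A 0 /\ forall a x y, A x -> A y -> A (a *: x + y).
Proof.
split=> [[]|[A0 AL]].
  rewrite unfold_in /= => A0 AL; split; first exact: set_mem A0.
  by move=> a x y /mem_set Ax /mem_set Ay; apply: set_mem; apply: AL.
split; first exact: mem_set.
by move=> a x y /set_mem Ax /set_mem Ay; apply: mem_set; apply: AL.
Qed.

Lemma subspace0 A : subspace A -> A 0.
Proof. by case/subspaceP. Qed.

Lemma subspaceL A : subspace A ->
  forall a x y, A x -> A y -> A (a *: x + y).
Proof. by case/subspaceP. Qed.

Lemma subspaceZ A : subspace A -> forall a x, A x -> A (a *: x).
Proof.
move=> sA a x Ax; rewrite -[_ *: _]addr0; apply: subspaceL => //.
exact: subspace0.
Qed.

Lemma subspaceD A : subspace A -> forall x y, A x -> A y -> A (x + y).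
Proof. by move=> sA x y Ax Ay; rewrite -[x]scale1r; apply: subspaceL. Qed.

Lemma subspaceN A : subspace A -> forall x, A x -> A (- x).
Proof. by move=> sA x Ax; rewrite -scaleN1r; apply: subspaceZ. Qed.

Lemma subspaceB A : subspace A -> forall x y, A x -> A y -> A (x - y).
Proof. by move=> sA x y Ax Ay; apply: subspaceD => //; apply: subspaceN. Qed.

Lemma subspace_sum A : subspace A ->
  forall (I : Type) (r : seq I) (Q : pred I) (F : I -> V),
  (forall i, Q i -> A (F i)) -> A (\sum_(i <- r | Q i) F i).
Proof.
move=> sA I r Q F AF; apply: big_ind => //; first exact: subspace0.
exact: subspaceD.
Qed.

Lemma subspace_set0 : subspace [set (0 : V)].
Proof.
by apply/subspaceP; split=> // a x y /= -> ->; rewrite scaler0 addr0.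
Qed.

Lemma lspan_gen A x : A x -> lspan A x.
Proof.
move=> Ax; exists 1%N, (fun=> 1), (fun=> x); split=> //.
by rewrite big_ord1 scale1r.
Qed.

Lemma lspan_subspace A : subspace (lspan A).
Proof.
apply/subspaceP; split.
  by exists 0%N, (fun=> 0), (fun=> 0); rewrite big_ord0; split=> // -[].
move=> a _ _ [r [b [x [Ax ->]]]] [s [c [y [Ay ->]]]].
exists (r + s)%N,
  (fun i => match fintype.split i with inl j => a * b j | inr j => c j end),
  (fun i => match fintype.split i with inl j => x j | inr j => y j end).
split; first by move=> i; case: (fintype.split i).
rewrite big_split_ord scaler_sumr; congr (_ + _); apply: eq_bigr => i _.
  by rewrite (unsplitK (inl i)) scalerA.
by rewrite (unsplitK (inr i)).
Qed.

Lemma lspan_min A P : subspace P -> A `<=` P -> lspan A `<=` P.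
Proof.
move=> sP AP _ [r [a [x [Ax ->]]]]; apply: subspace_sum => // i _.
by apply: subspaceZ => //; apply: AP.
Qed.

Lemma lspanS A B : A `<=` B -> lspan A `<=` lspan B.
Proof.
move=> AB; apply: lspan_min => [|x /AB]; first exact: lspan_subspace.
exact: lspan_gen.
Qed.

(** By Zorn's lemma, take [C] maximal among the linearly closed subsets of [B] that meet [A] at most
    in 0; if some [x] in [B] were outside [A + C], then [C + K x] would be larger. *)
Lemma exists_complement A B : subspace A -> subspace B -> A `<=` B ->
  exists C, [/\ subspace C, C `<=` B, forall x, C x -> A x -> x = 0 &
    forall x, B x -> exists2 y, A y & C (x - y)].
Proof.
move=> sA sB AB.
(* Closure under linear combinations does not force [0 \in C], so that the
   union of the empty chain is admissible. *)
pose good C := [/\ forall a x y, C x -> C y -> C (a *: x + y), C `<=` B &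
  forall x, C x -> A x -> x = 0].
have [|C [[CL CB CA0] Cmax]] := @Zorn_bigcup V good.
  move=> F Fgood Ftot; split.
  - move=> a x y [X FX Xx] [Y FY Yy]; have [XY|YX] := Ftot X Y FX FY.
      by exists Y => //; have [YL _ _] := Fgood Y FY; apply: YL; first exact: XY.
    by exists X => //; have [XL _ _] := Fgood X FX; apply: XL => //; apply: YX.
  - by move=> x [X FX Xx]; have [_ XB _] := Fgood X FX; apply: XB.
  - by move=> x [X FX Xx]; have [_ _ XA0] := Fgood X FX; apply: XA0.
(* A nonempty good set contains 0, as [(-1) *: x + x]; so if 0 were missing, [C] would be empty and
   [[set 0]] strictly larger. *)
have C0 : C 0.
  apply: contrapT => nC0; apply: (Cmax [set 0]); last first.
    split=> [a x y /= -> ->|x /= ->|x /= ->//]; last exact: subspace0.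
    by rewrite scaler0 addr0.
  have CF x : ~ C x.
    by move=> Cx; apply: nC0; have := CL (-1) x x Cx Cx; rewrite scaleN1r addNr.
  by split=> [x /CF //|/(_ 0 erefl)].
have sC : subspace C by apply/subspaceP.
exists C; split=> // x Bx; apply: contrapT => nx.
apply: (Cmax [set z | exists k, C (z - k *: x)]).
  split=> [z Cz|]; first by exists 0; rewrite scale0r subr0.
  move=> XC; have Cx : C x by apply: XC; exists 1; rewrite scale1r subrr.
  by apply: nx; exists 0; rewrite ?subr0 //; apply: subspace0.
split=> [a y z [k Ck] [l Cl]|z [k Cz]|z [k Cz] Az].
- exists (a * k + l).
  by rewrite scalerDl -scalerA opprD addrACA -scalerBr; apply: CL.
- rewrite -(subrK (k *: x) z).
  by apply: subspaceD => //; [apply: CB | apply: subspaceZ].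
(* For nonzero [k], dividing the element [z - k *: x] of [C] by [k] puts [x] in [A + C], against the
   choice of [x]. *)
- have [k0|k0] := eqVneq k 0.
    by apply: CA0 => //; move: Cz; rewrite k0 scale0r subr0.
  case: nx; exists (k^-1 *: z); first exact: subspaceZ.
  have := subspaceZ sC (- k^-1) Cz.
  by rewrite scalerBr scalerA mulNr mulVf // !scaleNr scale1r opprK addrC.
Qed.

Lemma fsbig_single (T : choiceType) (p : T) (F : T -> V) :
  (forall i, i != p -> F i = 0) -> \sum_(i \in [set: T]) F i = F p.
Proof.
move=> F0; transitivity (\sum_(i \in [set p]) F i); last exact: fsbig_set1.
by symmetry; apply: fsbig_widen => // i [_ /= /eqP]; apply: F0.
Qed.

End LinearAlgebra.

(** * Coefficients of the expansion of [(x - y)^n] *)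

Section Binomials.
Set Implicit Arguments.
Unset Strict Implicit.
Context {K : numFieldType}.

Lemma binz0 (n : int) : binz K n 0 = 1.
Proof. by rewrite /binz big_ord0 divr1. Qed.

Lemma binz_small (n : int) (k : nat) : 0 <= n < k%:Z -> binz K n k = 0.
Proof.
move=> nk; have lt_nk : (`|n| < k)%N by lia.
rewrite /binz (bigD1 (Ordinal lt_nk)) //= (_ : n - _ = 0) ?mul0r //.
by lia.
Qed.

Lemma subX_coef_eq0 (n a b : int) :
  ~~ ((0 <= b) && (a + b == n)) -> subX_coef K n a b = 0.
Proof. by rewrite /subX_coef => /negbTE ->. Qed.

Lemma subX_coef_neq0 (n a b : int) :
  subX_coef K n a b != 0 -> 0 <= b /\ a + b = n.
Proof.
rewrite /subX_coef; case: ifP => [/andP[-> /eqP]|_] //.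
by rewrite eqxx.
Qed.

(** For [0 <= n] the series [(x - y)^n] is a polynomial of degree [n] in [y]. *)
Lemma subX_coef_small (n a b : int) :
  0 <= n < b -> subX_coef K n a b = 0.
Proof.
move=> nb; rewrite /subX_coef; case: ifP => // _.
by rewrite binz_small ?mulr0 //; lia.
Qed.

Lemma subX_coefn0 (n : int) : subX_coef K n n 0 = 1.
Proof. by rewrite /subX_coef lexx addr0 eqxx binz0 mulr1. Qed.

End Binomials.

(** * Component formulas of the Jacobi identity, up to membership in a subspace *)

Section Modes.
Set Implicit Arguments.
Unset Strict Implicit.
Context {K : numFieldType} {V : vertexAlgebra K}.
Implicit Types (P : set V) (u v w : V).

Lemma mode0l (n : int) w : va_mode (0 : V) n w = 0.
Proof.
by have := va_linearl n w (-1) 0 0; rewrite scaler0 addr0 scaleN1r addNr.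
Qed.

Lemma subspace_preim_mode P (n : int) w :
  subspace P -> subspace [set v | P (va_mode v n w)].
Proof.
move=> sP; apply/subspaceP; split=> [|a x y /= Px Py].
  by rewrite /= mode0l; apply: subspace0.
by rewrite va_linearl; apply: subspaceL.
Qed.

Lemma mode0r v (n : int) : va_mode v n 0 = 0.
Proof.
by have := va_linearr v n (-1) 0 0; rewrite scaler0 addr0 scaleN1r addNr.
Qed.

Lemma subspace_preim_moder P v (n : int) :
  subspace P -> subspace [set w | P (va_mode v n w)].
Proof.
move=> sP; apply/subspaceP; split=> [|a x y /= Px Py].
  by rewrite /= mode0r; apply: subspace0.
by rewrite va_linearr; apply: subspaceL.
Qed.

(** A sum with infinite support is 0 by convention, which also lies in [P], so finiteness of the
    support need not be checked. *)
Lemma subspace_mul3 P (f : series3 K) (g : series3 V) (a b c : int) :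
  subspace P ->
  (forall i j k, f i j k != 0 -> P (g (a - i) (b - j) (c - k))) ->
  P (mul3 f g a b c).
Proof.
move=> sP Pg; apply: subspace_sum => // -[[i j] k] _ /=.
have [->|/Pg] := eqVneq (f i j k) 0; last exact: subspaceZ.
by rewrite scale0r; apply: subspace0.
Qed.

(* [u_m v_n w = v_n u_m w + \sum_(j >= 0) 'C(m, j) (u_j v)_(m+n-j) w] *)
Lemma mode_commutator P u v w (m n : int) : subspace P ->
  P (va_mode v n (va_mode u m w)) ->
  (forall j : int, 0 <= j -> P (va_mode (va_mode u j v) (m + n - j) w)) ->
  P (va_mode u m (va_mode v n w)).
Proof.
(* The residue in [x0], that is the coefficient of [x0^-1], leaves only the power 0 of [x1 - x2] and
   of [x2 - x1], so each product on the left reduces to one term. *)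
move=> sP Pvu Puv; have := va_jacobi u v w (-1) (- m - 1) (- n - 1).
have d0 i : ((-1) - i == 0 :> int) = (i == -1) by lia.
rewrite {1}/mul3 (@fsbig_single _ _ _ (-1, 0, 0)) /=; last first.
  move=> [[i j] k] ne; rewrite /delta12 /prodY12 /= d0.
  case: eqP => [i1|_]; last by rewrite scaler0.
  have [k0|k0] := eqVneq k 0.
    rewrite subX_coef_eq0 ?scale0r //; apply: contra ne => /andP[_ /eqP].
    by move=> h; apply/eqP; congr (_, _, _); lia.
  rewrite i1; have [k_ge0|k_lt0] := leP 0 k; last first.
    by rewrite subX_coef_eq0 ?scale0r //; lia.
  by rewrite subX_coef_small ?scale0r //; lia.
rewrite {1}/mul3 (@fsbig_single _ _ _ (-1, 0, 0)) /=; last first.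
  move=> [[i j] k] ne; rewrite /delta21 /prodY21 /= d0.
  case: eqP => [i1|_]; last by rewrite scaler0.
  have [j0|j0] := eqVneq j 0.
    rewrite subX_coef_eq0 ?mulr0 ?scale0r //; apply: contra ne => /andP[_ /eqP].
    by move=> h; apply/eqP; congr (_, _, _); lia.
  rewrite i1; have [j_ge0|j_lt0] := leP 0 j; last first.
    by rewrite subX_coef_eq0 ?mulr0 ?scale0r //; lia.
  by rewrite subX_coef_small ?mulr0 ?scale0r //; lia.
rewrite /delta12 /delta21 /prodY12 /prodY21 d0 eqxx.
rewrite (_ : - (-1) - 1 = 0 :> int) // subX_coefn0 expr0z mulr1 !scale1r.
rewrite (_ : - (- m - 1 - 0) - 1 = m); last by lia.
rewrite (_ : - (- n - 1 - 0) - 1 = n); last by lia.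
move/eqP; rewrite subr_eq => /eqP ->; apply: subspaceD => //.
apply: subspace_mul3 => // i j k; rewrite /delta10 => nz.
have [i_ge0 e] : 0 <= i /\ j + i = - k - 1.
  exact: subX_coef_neq0 nz.
rewrite /iterY; case: eqP => [ej|_]; last exact: subspace0.
rewrite (_ : - (-1 - i) - 1 = i); last by lia.
by rewrite (_ : - (- n - 1 - k) - 1 = m + n - i); [exact: Puv | lia].
Qed.

(* [(u_l v)_n w = \sum_(i >= 0) (-1)^i 'C(l, i)
     (u_(l-i) v_(n+i) w - (-1)^l v_(n+l-i) u_i w)] *)
Lemma mode_iterate P u v w (l n : int) : subspace P ->
  (forall i : int, 0 <= i -> P (va_mode u (l - i) (va_mode v (n + i) w))) ->
  (forall i : int, 0 <= i -> P (va_mode v (n + l - i) (va_mode u i w))) ->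
  P (va_mode (va_mode u l v) n w).
Proof.
(* The residue in [x1] forces [j = -1] on the right; what remains there are the coefficients of
   [x0^i] in [(x1 - x0)^(i-1)], which vanish for [i > 0]. *)
move=> sP Puv Pvu; have := va_jacobi u v w (- l - 1) (-1) (- n - 1).
have d0 i : ((-1) - i == 0 :> int) = (i == -1) by lia.
rewrite [X in _ = X]/mul3 (@fsbig_single _ _ _ (0, -1, 0)) /=; last first.
  move=> [[i j] k] ne; rewrite /delta10 /iterY /= d0.
  case: eqP => [j1|_]; last by rewrite scaler0.
  have [i0|i0] := eqVneq i 0.
    rewrite subX_coef_eq0 ?scale0r //; apply: contra ne => /andP[_ /eqP].
    by move=> h; apply/eqP; congr (_, _, _); lia.
  case: (boolP ((0 <= i) && (j + i == - k - 1))) => [|/subX_coef_eq0->];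
    last by rewrite scale0r.
  by move=> /andP[i_ge0 /eqP e]; rewrite subX_coef_small ?scale0r //; lia.
rewrite /delta10 /iterY d0 eqxx (_ : - 0 - 1 = -1 :> int) //.
rewrite subX_coefn0 scale1r.
rewrite (_ : - (- l - 1 - 0) - 1 = l); last by lia.
rewrite (_ : - (- n - 1 - 0) - 1 = n); last by lia.
move=> <-; apply: subspaceB => //; apply: subspace_mul3 => // i j k.
  rewrite /delta12 => nz.
  have [k_ge0 e] : 0 <= k /\ j + k = - i - 1.
    exact: subX_coef_neq0 nz.
  rewrite /prodY12; case: eqP => [ei|_]; last exact: subspace0.
  rewrite (_ : - (-1 - j) - 1 = l - k); last by lia.
  by rewrite (_ : - (- n - 1 - k) - 1 = n + k); [exact: Puv | lia].
rewrite /delta21 => nz.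
have [j_ge0 e] : 0 <= j /\ k + j = - i - 1.
  by apply: (@subX_coef_neq0 K); apply: contraNneq nz => ->; rewrite mulr0.
rewrite /prodY21; case: eqP => [ei|_]; last exact: subspace0.
rewrite (_ : - (-1 - j) - 1 = j); last by lia.
by rewrite (_ : - (- n - 1 - k) - 1 = n + l - j); [exact: Pvu | lia].
Qed.

End Modes.

(** * The spaces [E_n^U]: induction on words and monotonicity *)

Section Filtration.
Set Implicit Arguments.
Unset Strict Implicit.
Context {K : numFieldType} {V : vertexAlgebra K}.
Implicit Types (D : nat -> set V) (P : set V) (u v w : V) (m n : int).

Lemma EU_subspace D n : subspace (EU D n).
Proof.
by case: n => k; [exact: lspan_subspace | exact: subspace_set0].
Qed.

Lemma EU0 D n : EU D n 0.
Proof. by apply: subspace0; apply: EU_subspace. Qed.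

Lemma EU_neg D (n : int) v : n < 0 -> EU D n v -> v = 0.
Proof. by case: n. Qed.

Lemma EU_vac D n : 0 <= n -> EU D n (va_vac V).
Proof.
case: n => // n _; apply: lspan_gen; exists [::] => //.
by split; rewrite ?big_nil.
Qed.

(** Induction on the length of a word. Its degree is only bounded by [k], and the bound left at the
    empty word may be positive; hence the vacuum is required in every [P n] with [0 <= n]. *)
Lemma EU_ind D (P : int -> set V) :
  (forall n, subspace (P n)) ->
  (forall n, 0 <= n -> P n (va_vac V)) ->
  (forall (m k : nat) n u v, (0 < m)%N -> (0 < k)%N -> D m u ->
     EU D n v -> P n v -> P (m%:Z + n) (va_mode u (- k%:Z) v)) ->
  forall n, EU D n `<=` P n.
Proof.
move=> sP Pvac Pcons [k|k]; last first.
  by move=> v /= ->; apply: subspace0.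
apply: lspan_min => // _ [s [sD ks] <-].
elim: s k sD ks => [|[[u m] l] s IH] k sD; first by move=> _; apply: Pvac.
rewrite big_cons /= => ks.
have sD' t : t \in s -> [/\ (0 < t.1.2)%N, (0 < t.2)%N & D t.1.2 t.1.1].
  by move=> ts; apply: sD; rewrite in_cons ts orbT.
have [/= m0 l0 Du] := sD (u, m, l) (mem_head _ _).
have ks' : (\sum_(t <- s) t.1.2 <= k - m)%N by lia.
rewrite (_ : k%:Z = m%:Z + (k - m)%N%:Z); last by lia.
apply: Pcons => //; last exact: IH.
by apply: lspan_gen; exists s.
Qed.

Lemma EU_cons D (m k : nat) n u v : (0 < m)%N -> (0 < k)%N -> D m u ->
  EU D n v -> EU D (m%:Z + n) (va_mode u (- k%:Z) v).
Proof.
move=> m0 k0 Du; case: n => [n|n]; last first.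
  by move=> /= ->; rewrite mode0r; apply: EU0.
move: v; apply: lspan_min.
  by apply: subspace_preim_moder; apply: (EU_subspace D (m%:Z + n)).
move=> _ [s [sD ns] <-]; rewrite -PoszD; apply: lspan_gen.
exists ((u, m, k) :: s) => //; split; last by rewrite big_cons /=; lia.
by move=> t; rewrite in_cons => /predU1P[->|/sD].
Qed.

Lemma EU_le D m n : m <= n -> EU D m `<=` EU D n.
Proof.
case: m => [m|m] le_mn; last by move=> v /EU_neg -> //; apply: EU0.
case: n le_mn => // n le_mn.
apply: lspanS => _ [s [sD ms] <-]; exists s => //; split=> //.
exact: leq_trans ms _.
Qed.

Lemma EU_gen D (m : nat) u : (0 < m)%N -> D m u -> EU D m u.
Proof.
move=> m0 Du; rewrite -[u]va_creation -[m%:Z]addr0.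
by apply: (@EU_cons _ _ 1) => //; apply: EU_vac.
Qed.

(** * Products of elements of the spaces [E_n^U] *)

Lemma subspace_forall (T : Type) (A : T -> set V) :
  (forall i, subspace (A i)) -> subspace [set v | forall i, A i v].
Proof.
move=> sA; apply/subspaceP; split=> [i|a x y Ax Ay i]; first exact: subspace0.
exact: subspaceL.
Qed.

(** The boolean [0 <= j], read as 0 or 1, joins the two bounds. They are proved together because the
    modes to which the induction hypothesis is applied can have either sign. *)
Lemma EU_products D : nneg_products_lower D ->
  forall (m n : int) u v (j : int), EU D m u -> EU D n v ->
  EU D (m + n - (0 <= j)%R%:Z) (va_mode u j v).
Proof.
move=> lowD m n.
have [N] : exists N : nat, m + n < N%:Z by exists `|(m + n)%R|.+1; lia.
elim: N m n => [|N IH] m n ltN u v j Eu Ev.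
  (* Here [m + n < 0], so one of the two spaces is zero. *)
  have [m0|m0] := ltP m 0.
    by rewrite (EU_neg m0 Eu) mode0l; apply: EU0.
  have n0 : n < 0 by lia.
  by rewrite (EU_neg n0 Ev) mode0r; apply: EU0.
have gen_nneg (p : nat) (k : int) w x (i : int) : (0 < p)%N ->
    p%:Z + k < N.+1%:Z -> D p w -> EU D k x -> 0 <= i ->
    EU D (p%:Z + k - 1) (va_mode w i x).
  move=> p0 + Dw Ex; move: i => /[swap].
  move: k x Ex.
  apply: (EU_ind (P := fun k => [set x | p%:Z + k < N.+1%:Z -> forall i : int,
    0 <= i -> EU D (p%:Z + k - 1) (va_mode w i x)])).
  (* An implication is a quantification over proofs of its premise, so [subspace_forall] covers it
     too. *)
  - move=> k; do 3!apply: subspace_forall => ?.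
    by apply: subspace_preim_moder; apply: EU_subspace.
  - by move=> k k0 _ i i0; rewrite va_creation0 //; apply: EU0.
  move=> q l k w' x q0 l0 Dw' Ex IHx pqk i i0.
  apply: mode_commutator; first exact: EU_subspace.
    rewrite (_ : _ - 1 = q%:Z + (p%:Z + k - 1)); last by lia.
    by apply: EU_cons => //; apply: IHx => //; lia.
  move=> h h0.
  (* The drop by one in the degree of [w_h w'] both makes [IH] applicable and gives the required
     bound, whatever the sign of the outer mode. *)
  apply: (@EU_le _ (p%:Z + q%:Z - 1 + k - (0 <= i + - l%:Z - h)%R%:Z)).
    by lia.
  by apply: IH => //; [lia | exact: lowD].
move: m u Eu ltN v Ev j.
apply: (EU_ind (P := fun m => [set u | m + n < N.+1%:Z ->
  forall v, EU D n v -> forall j : int,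
  EU D (m + n - (0 <= j)%R%:Z) (va_mode u j v)])).
- move=> m; do 4!apply: subspace_forall => ?.
  by apply: subspace_preim_mode; apply: EU_subspace.
- move=> m m0 ltN v Ev j; rewrite va_vacl; case: eqP => [->|_].
    by apply: EU_le Ev; lia.
  exact: EU0.
move=> p l m w u p0 l0 Dw Eu IHu ltN v Ev j.
apply: mode_iterate => [|i i0|i i0]; first exact: EU_subspace.
(* The outer mode stays negative, and [0 <= j] implies [0 <= j + i], so any drop required is
   inherited from [IHu]. *)
- rewrite (_ : - l%:Z - i = - (l + `|i|)%N%:Z); last by lia.
  apply: (@EU_le _ (p%:Z + (m + n - (0 <= j + i)%R%:Z))); first by lia.
  by apply: EU_cons => //; [lia | apply: IHu => //; lia].
apply: (@EU_le _ (m + (p%:Z + n - 1) - (0 <= j + - l%:Z - i)%R%:Z)).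
  by lia.
(* Only for [0 <= m] does the bound on [p + m + n] yield the bound on [p + n] that [gen_nneg]
   requires. *)
have [m0|m0] := ltP m 0.
  by rewrite (EU_neg m0 Eu) mode0l; apply: EU0.
by apply: IH => //; [lia | apply: gen_nneg => //; lia].
Qed.

(** * Exhaustion of [V] and the good filtration *)

Lemma EU_bigcup_subspace D : subspace (\bigcup_(n in [set: nat]) EU D n%:Z).
Proof.
apply/subspaceP; split=> [|a x y [n _ Ex] [p _ Ey]].
  by exists 0%N => //; apply: EU0.
exists (maxn n p) => //; apply: subspaceL; first exact: EU_subspace.
  by apply: EU_le Ex; lia.
by apply: EU_le Ey; lia.
Qed.

(** The union is a subspace that contains the vacuum and, by [EU_products], is stable under all
    modes of elements of [U]; so it contains every word in [U]. *)
Lemma EU_bigcup D U : graded_decomposition U D -> generates U ->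
  nneg_products_lower D -> [set: V] = \bigcup_(n in [set: nat]) EU D n%:Z.
Proof.
move=> [_ _ defU _] genU lowD; apply/seteqP; split=> // v _.
have sW := EU_bigcup_subspace D; set W := (X in X v).
have W_U u : U u -> forall (j : int) w, W w -> W (va_mode u j w).
  rewrite defU; move: u; apply: lspan_min.
    by do 3!apply: subspace_forall => ?; apply: subspace_preim_mode.
  move=> u [m m0 Du] j w [n _ Ew]; exists (m + n)%N => //.
  by apply: EU_le (EU_products lowD j (EU_gen m0 Du) Ew); lia.
have : lspan [set word s | s in
  [set s : seq (V * int) | forall t, t \in s -> U t.1]] v by rewrite genU.
move: v; apply: lspan_min => // _ [s sU <-].
elim: s sU => [|[u j] s IH] sU; first by exists 0%N => //; apply: EU_vac.
apply: W_U; first exact: (sU (u, j) (mem_head _ _)).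
by apply: IH => t ts; apply: sU; rewrite in_cons ts orbT.
Qed.

Lemma EU_sub_lspan D U n : (forall m : nat, (0 < m)%N -> D m `<=` U) ->
  EU D n `<=` lspan [set word [seq (t.1, - t.2%:Z) | t <- s] | s in
    [set s : seq (V * nat) | forall t, t \in s -> U t.1 /\ (0 < t.2)%N]].
Proof.
move=> DU; case: n => n; last first.
  by move=> v /EU_neg -> //; apply: subspace0; apply: lspan_subspace.
apply: lspanS => _ [s [sD _] <-]; exists [seq (t.1.1, t.2) | t <- s].
  by move=> _ /mapP[t /sD[m0 k0 Du] ->]; split=> //; apply: DU Du.
by rewrite -map_comp.
Qed.

Lemma graded_decomposition_sub U D : graded_decomposition U D ->
  forall m : nat, (0 < m)%N -> D m `<=` U.
Proof. by move=> [_ _ -> _] m m0 u Du; apply: lspan_gen; exists m. Qed.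

Lemma EU_good_filtration D U : graded_decomposition U D -> generates U ->
  nneg_products_lower D -> good_filtration (EU D).
Proof.
move=> gradU genU lowD; split.
- exact: EU_subspace.
- by move=> n; apply: EU_le; lia.
- apply/seteqP; split=> // v _.
  have : [set: V] v by [].
  by rewrite (EU_bigcup gradU genU lowD) => -[n _ Ev]; exists n%:Z.
- exact: EU_vac.
- by move=> m n u v j Eu Ev j0; apply: EU_le (EU_products lowD j Eu Ev); lia.
- by move=> m n u v j Eu Ev j0; apply: EU_le (EU_products lowD j Eu Ev); lia.
Qed.

(** * The converse: generators from a good filtration *)

Lemma good_filtration_le (E : int -> set V) (m n : int) :
  good_filtration E -> m <= n -> E m `<=` E n.
Proof.
move=> gE le_mn; rewrite (_ : n = m + `|n - m|%N%:Z); last by lia.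
elim: `|n - m|%N => [|k IH] v Ev; first by rewrite addr0.
rewrite (_ : _ + _ = m + k%:Z + 1); last by lia.
by apply: gf_incr => //; apply: IH.
Qed.

Lemma good_filtration_EU (E : int -> set V) : good_filtration E ->
  (forall n : int, n < 0 -> E n = [set 0]) -> E 0 = lspan [set va_vac V] ->
  exists (U : set V) (D : nat -> set V),
    [/\ graded_decomposition U D, generates U, nneg_products_lower D &
        forall n : int, E n = EU D n].
Proof.
move=> gE Eneg E0; have sE := gf_subspace gE.
have /choice[D DP] (n : nat) : exists C : set V, [/\ subspace C, C `<=` E n,
    forall x, C x -> E (n%:Z - 1) x -> x = 0 &
    forall x, E n x -> exists2 y, E (n%:Z - 1) y & C (x - y)].
  by apply: exists_complement => //; apply: good_filtration_le => //; lia.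
have DE (n : nat) : D n `<=` E n by case: (DP n).
have EUE (n : int) : EU D n `<=` E n.
  move: n; apply: EU_ind => // [n n0|m k n u v m0 k0 Du _ Ev].
    by apply: good_filtration_le n0 _ _ => //; apply: gf_vac.
  by apply: gf_neg => //; [apply: DE | lia].
(* Induction on the degree from [E 0], spanned by the vacuum: modulo [E n], an element of [E n.+1]
   lies in [D n.+1]. *)
have EEU (n : int) : E n `<=` EU D n.
  case: n => [n|n]; last by rewrite Eneg.
  elim: n => [|n IH] x Ex.
    move: Ex; rewrite E0; move: x; apply: lspan_min; first exact: EU_subspace.
    by move=> _ ->; apply: EU_vac.
  have [_ _ _ /(_ x Ex)[y Ey Dxy]] := DP n.+1.
  rewrite -(subrK y x); apply: subspaceD; first exact: EU_subspace.
    exact: EU_gen.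
  apply: (@EU_le _ n); first by lia.
  by apply: IH; rewrite (_ : n%:Z = n.+1%:Z - 1) //; lia.
have gradU : graded_decomposition
    (lspan (\bigcup_(n in [set n | (0 < n)%N]) D n)) D.
  split=> //; first exact: lspan_subspace.
    by move=> n _; case: (DP n).
  elim=> [|N IH] x Dx; first by move=> _ n; lia.
  rewrite big_nat_recr //= => sum0.
  (* The top component is minus the sum of the lower ones, so it lies in [E N], which meets [D N.+1]
     only in 0. *)
  have xN : x N.+1 = 0.
    have [_ _ D0 _] := DP N.+1; apply: D0; first exact: Dx.
    rewrite (_ : _ - 1 = N%:Z); last by lia.
    move/eqP: sum0; rewrite addrC addr_eq0 => /eqP ->.
    apply: subspaceN => //; rewrite big_nat_cond; apply: subspace_sum => // i.
    rewrite andbT => /andP[i0 iN]; apply: (@good_filtration_le _ i) => //.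
    by apply: DE; apply: Dx.
  move: sum0; rewrite xN addr0 => /(IH x Dx) x0 n nN.
  by have [->//|neN] := eqVneq n N.+1; apply: x0; lia.
exists (lspan (\bigcup_(n in [set n | (0 < n)%N]) D n)), D; split=> //.
- apply/seteqP; split=> // v _.
  have [n _ /EEU] : (\bigcup_(n in [set: int]) E n) v by rewrite gf_exhaustive.
  move=> /(EU_sub_lspan (graded_decomposition_sub gradU)).
  apply: lspanS => _ [s sU <-]; exists [seq (t.1, - t.2%:Z) | t <- s] => //.
  by move=> _ /mapP[t /sU[Ut _] ->].
- by move=> m n u v i m0 n0 /DE Eu /DE Ev i0; apply: EEU; apply: gf_nneg.
- by move=> n; apply/seteqP; split.
Qed.

End Filtration.

Theorem theorem4p6 (R : realType) (V : vertexAlgebra R[i]) :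
  (forall (U : set V) (D : nat -> set V),
     graded_decomposition U D ->
     generates U ->
     nneg_products_lower D ->
     [/\ good_filtration (EU D),
         [set: V] = \bigcup_(n in [set: nat]) EU D n%:Z &
         [set: V] = lspan [set word [seq (t.1, - t.2%:Z) | t <- s] | s in
           [set s : seq (V * nat) |
              forall t, t \in s -> U t.1 /\ (0 < t.2)%N]]])
  /\
  (forall E : int -> set V,
     good_filtration E ->
     (forall n : int, n < 0 -> E n = [set 0]) ->
     E 0 = lspan [set va_vac V] ->
     exists (U : set V) (D : nat -> set V),
       [/\ graded_decomposition U D,
           generates U,
           nneg_products_lower D &
           forall n : int, E n = EU D n]).
Proof.
split=> [U D gradU genU lowD|E]; last exact: good_filtration_EU.
split; [exact: EU_good_filtration genU lowD | exact: EU_bigcup genU lowD |].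
apply/seteqP; split=> // v; rewrite (EU_bigcup gradU genU lowD) => -[n _].
by apply: EU_sub_lspan; apply: graded_decomposition_sub gradU.
Qed.
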